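(* If $g(I)$ is additive and absolutely continuous, then for every Lebesgue measurable set $E\subset W$, $$(D;G)\overline{\int}_E g(I)=(D;G)\underline{\int}_E g(I)=g(E),$$ where $g(E)$ is the Lebesgue integral of $g(I)$ over $E$.
   Context: $W=[A,B]$ with $A<B$ is a fixed closed interval. An interval is any of $(a,b),[a,b),(a,b],[a,b]$ with $A\le a<b\le B$; $mI=b-a$, and $m$ also denotes Lebesgue measure. Two intervals overlap if they have a non-degenerate interval in common. $S$ is a set of intervals and $g$ is a real function defined on $S$. It is additive (in $S$) if for all $x<y<z$: $g((x,y])+g((y,z))=g((x,z))$ whenever $(x,y],(y,z),(x,z)$ are in $S$; $g((x,y))+g([y,z))=g((x,z))$ whenever $(x,y),[y,z),(x,z)$ are in $S$; and the six corresponding relations using different bracket conventions at $x$ and $z$ are also true. It is absolutely continuous (in $W$) if for every $\varepsilon>0$ there is $\delta>0$ such that $|\sum g(I)|<\varepsilon$ for every finite set of pairwise non-overlapping intervals $I$ of $S$ with total length less than $\delta$. For additive, absolutely continuous $g(I)$ the derivative $g'(x)$ of $g(I)$ (the limit of $g(I)/mI$ as the intervals $I$ of $S$ containing $x$ shrink to $x$) exists almost everywhere in $W$ and is integrable over $W$, and the Lebesgue integral of $g(I)$ over a measurable set $E$ is $g(E)=\int_E g'(x)\,dx$. A division of $W$ is a finite set of pairwise non-overlapping intervals of $S$ the union of whose closures is $W$; its norm is the greatest length of its intervals. A Riemann succession of divisions of $W$ is a sequence of divisions of $W$ with norms tending to $0$. $G$ is the set of divisions occurring in a family $F$ of Riemann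 successions that contains at least one Riemann succession of divisions of $W$, and such that $\{D_{n_i}\}\in F$ whenever $\{D_n\}\in F$ and $n_i\to\infty$ are integers. For measurable $E\subset W$ put $K(I)=\dfrac{g(I)\,m(E\cap I)}{mI}$. The upper density integral is $(D;G)\overline{\int}_E g(I)=\lim_{e\to0}\sup\{\sum_{I\in D}K(I):D\in G\text{ a division of }W,\ \mathrm{norm}(D)<e\}$; the lower density integral $(D;G)\underline{\int}_E g(I)$ is the same with $\inf$.
   Formalization: Existence almost everywhere in W of the derivative g'(x), taken along intervals of S containing x, is assumed explicitly: for an arbitrary S it need not follow from additivity and absolute continuity, and then g(E) is undefined. Integrability of g' is proved. *)

(* Defs.v *)
From HB Require Import structures.
From mathcomp Require Import all_boot all_order all_algebra finmap.
From mathcomp Require Import all_classical all_reals all_analysis.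

Set Implicit Arguments.
Unset Strict Implicit.
Unset Printing Implicit Defensive.

Import Order.TTheory GRing.Theory Num.Theory.
Import numFieldNormedType.Exports.

Local Open Scope classical_set_scope.
Local Open Scope ring_scope.

Section IntervalFunctions.
Context {R : realType}.
Implicit Types (A B a b x y z : R) (I J K : interval R) (S : set (interval R))
  (g : interval R -> R) (D : {fset interval R}) (u : nat -> {fset interval R})
  (E : set R).

(** Intervals are kept as syntactic bounds ([interval R]); on non-degenerate
    bounded intervals this is the same as working with point sets. *)
Definition itv_in A B I : bool :=
  if I is Interval (BSide _ a) (BSide _ b) then [&& A <= a, a < b & b <= B]
  else false.

Definition itv_length I : R :=
  if I is Interval (BSide _ a) (BSide _ b) then b - a else 0.

Definition overlap I J : Prop :=
  exists (K : interval R) (a b : R),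
    itv_in a b K /\ [set` K] `<=` [set` I] `&` [set` J].

Definition nonoverlapping D : Prop :=
  {in D &, forall I J, I != J -> ~ overlap I J}.

(** [BSide r y] as a right bound and as a left bound are complementary: [r = true]
    gives  ..,y) and [y,..  while [r = false] gives  ..,y] and (y,.. .
    The three booleans thus range over the eight additivity relations. *)
Definition additive_on S g : Prop :=
  forall (x y z : R) (p q r : bool), x < y -> y < z ->
    S (Interval (BSide p x) (BSide r y)) ->
    S (Interval (BSide r y) (BSide q z)) ->
    S (Interval (BSide p x) (BSide q z)) ->
    g (Interval (BSide p x) (BSide r y)) + g (Interval (BSide r y) (BSide q z))
      = g (Interval (BSide p x) (BSide q z)).

Definition abs_continuous_on S g : Prop :=
  forall eps : R, 0 < eps -> exists2 delta : R, 0 < delta &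
    forall D, [set` D] `<=` S -> nonoverlapping D ->
      \sum_(I <- D) itv_length I < delta -> `|\sum_(I <- D) g I| < eps.

(** The intervals of [S] containing [x], shrinking to [x]. *)
Definition shrink_to S x : set_system (interval R) :=
  filter_from [set d : R | 0 < d]
    (fun d => [set I | [/\ S I, x \in I & itv_length I < d]]).

Definition itv_derivable S g x : Prop :=
  cvg (g I / itv_length I @[I --> shrink_to S x]).

(** An unspecified value where the limit does not exist. *)
Definition itv_derive S g x : R :=
  lim (g I / itv_length I @[I --> shrink_to S x]).

Definition division S a b D : Prop :=
  [/\ [set` D] `<=` S, nonoverlapping D &
      \bigcup_(I in [set` D]) closure [set` I] = `[a, b]%classic].

Definition div_norm D : R := \big[Order.max/0]_(I <- D) itv_length I.

Definition Riemann_succession S a b u : Prop :=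
  (forall n, division S a b (u n)) /\ div_norm (u n) @[n --> \oo] --> 0.

(** The family may also contain successions dividing other subintervals of
    [W = [A, B]], as long as one of its members divides [W] itself. *)
Definition succession_family S A B (F : set (nat -> {fset interval R})) : Prop :=
  [/\ forall u, F u ->
        exists a b, [/\ A <= a, a < b, b <= B & Riemann_succession S a b u],
      exists2 u, F u & Riemann_succession S A B u &
      forall u (phi : nat -> nat), F u -> phi @ \oo --> \oo -> F (u \o phi)].

Definition occurring (F : set (nat -> {fset interval R})) :
    set {fset interval R} :=
  [set D | exists2 u, F u & exists n, u n = D].

(** Measurability in Lebesgue's (Caratheodory's) sense, not only Borel sets. *)
Definition lebesgue_measurable E : Prop :=
  ((wlength idfun)^*)%mu.-cara.-measurable E.

Definition lebesgue_itv_integral S g E : \bar R :=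
  (\int[completed_lebesgue_measure]_(x in E) (itv_derive S g x)%:E)%E.

Definition density_summand g E I : R :=
  g I * fine (completed_lebesgue_measure (E `&` [set` I])) / itv_length I.

Definition density_sums S A B g (G : set {fset interval R}) E (e : R) :
    set (\bar R) :=
  [set (\sum_(I <- D) density_summand g E I)%:E |
    D in [set D | [/\ G D, division S A B D & div_norm D < e]]].

Definition upper_density_integral S A B g G E : \bar R :=
  lim (ereal_sup (density_sums S A B g G E e) @[e --> 0^'+]).

Definition lower_density_integral S A B g G E : \bar R :=
  lim (ereal_inf (density_sums S A B g G E e) @[e --> 0^'+]).

End IntervalFunctions.

(* Main.v *)
Require Import Defs.
From HB Require Import structures.
From mathcomp Require Import all_boot all_order all_algebra finmap.
From mathcomp Require Import all_classical all_reals all_analysis.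
From mathcomp Require Import measurable_realfun lra.

Set Implicit Arguments.
Unset Strict Implicit.
Unset Printing Implicit Defensive.

Import Order.TTheory GRing.Theory Num.Theory.
Import numFieldNormedType.Exports.

Local Open Scope classical_set_scope.
Local Open Scope ring_scope.

(** A division [D] of [`[A, B]] turns [g] into the step function whose value on
    each [I] of [D] is the mean slope [g I / itv_length I], and the density sum
    of [D] is exactly the integral over [E] of this step function
    ([integral_step]).  Along a Riemann succession, almost every point of
    [`[A, B]] lies, for every [n], in exactly one interval of the [n]-th division, and
    these intervals shrink to it; so the step functions converge almost
    everywhere to the derivative of [g] ([ae_cvg_step]).  What remains is to pass
    to the limit under the integral.

    The step functions have no common integrable bound in general, but absolute
    continuity makes them uniformly integrable: in a fine division the intervals
    with slope above [K] in absolute value have small total length when [K] is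
    large, hence contribute little to the sum of [`|g I|]
    ([abs_continuous_steep]).  This first bounds the integrals of the absolute
    values of the step functions, so Fatou's lemma makes the derivative integrable
    ([integrable_itv_derive]).  It also shows that truncating all slopes at
    absolute value [K] changes the density sums by at most a small amount, uniformly in
    the division ([density_sum_clamp]); the truncated step functions are bounded,
    so dominated convergence applies to them, and once more to the truncated
    derivative as [K] grows.  Thus the density sums converge to the integral along
    every Riemann succession ([density_sums_cvg]).

    A sequence of divisions with norms tending to 0 is a Riemann succession,
    so the convergence is uniform in the norm ([division_sums_near]): all
    density sums of divisions of small norm are near the integral.  The upper and
    lower density integrals are limits of suprema and infima of nonempty sets of
    such sums. *)

(** * Interval lengths and the completed Lebesgue measure *)

(** Instance search does not see the measure structure of
    [completed_lebesgue_measure] through its Caratheodory carrier. *)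
#[local] Instance completed_ae_filter {R : realType} :
  Filter (nbhs (almost_everywhere (@completed_lebesgue_measure R))).
Proof. exact: (ae_filter_ringOfSetsType completed_lebesgue_measure). Qed.

Section CompletedLebesgue.
Context {R : realType}.
Local Notation mu := (@completed_lebesgue_measure R).
Implicit Types (I J : interval R) (D : {fset interval R}) (E : set R).

Lemma itv_length_gt0 A B I : itv_in A B I -> 0 < itv_length I.
Proof.
by case: I => -[p a|p] [q b|q] //= /and3P[_ + _]; rewrite subr_gt0.
Qed.

Lemma lebesgue_measurable_itv I : lebesgue_measurable [set` I].
Proof. by apply: sub_caratheodory; exact: (measurable_itv I). Qed.

(** The completed measure and [lebesgue_measure] are the same outer measure,
    restricted to different sigma-algebras. *)
Lemma completed_measure_itv A B I :
  itv_in A B I -> mu [set` I] = (itv_length I)%:E.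
Proof.
case: I => -[p a|p] [q b|q] //= /and3P[_ ab _].
have -> : mu [set` Interval (BSide p a) (BSide q b)] =
  lebesgue_measure [set` Interval (BSide p a) (BSide q b)] by [].
by rewrite lebesgue_measure_itv/= lte_fin ab EFinB.
Qed.

Lemma completed_measure_setI_itv A B E I : lebesgue_measurable E ->
  itv_in A B I ->
  mu (E `&` [set` I]) \is a fin_num /\
  0 <= fine (mu (E `&` [set` I])) <= itv_length I.
Proof.
move=> mE hI; have le : (mu (E `&` [set` I]) <= (itv_length I)%:E)%E.
  rewrite -(completed_measure_itv hI); apply: le_measure; rewrite ?inE.
  - by apply: measurableI => //; exact: lebesgue_measurable_itv.
  - exact: lebesgue_measurable_itv.
  - exact: subIsetr.
have fin : mu (E `&` [set` I]) \is a fin_num.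
  by rewrite ge0_fin_numE ?measure_ge0//; apply: le_lt_trans le _; rewrite ltry.
split => //.
by rewrite fine_ge0 ?measure_ge0//= -lee_fin fineK.
Qed.

Definition step (h : interval R -> R) D (x : R) : R :=
  \sum_(I <- D) h I * \1_[set` I] x.

Lemma measurable_step h D E :
  measurable_fun (E : set (caratheodory_type (wlength idfun)^*%mu))
    (EFin \o step h D).
Proof.
apply/measurable_EFinP; apply: measurable_sum => I.
apply: measurable_funM => //; apply: measurable_indic.
exact: lebesgue_measurable_itv.
Qed.

(** With [h I = g I / itv_length I] the right-hand side is the density sum of
    [D]; with [h] constant it measures how much of [E] the division covers. *)
Lemma integral_step A B h D E : lebesgue_measurable E ->
  [set` D] `<=` itv_in A B ->
  (\int[mu]_(x in E) (step h D x)%:E)%E =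
  (\sum_(I <- D) h I * fine (mu (E `&` [set` I])))%:E.
Proof.
move=> mE hD.
(* [integral_sum] asks for integrability at every index, also outside [D],
   where the interval may be unbounded. *)
pose h' I := if itv_in A B I then h I else 0.
have hh' I : I \in D -> h I = h' I by move=> /hD hI; rewrite /h' hI.
have ind I : itv_in A B I -> mu.-integrable E (EFin \o \1_[set` I]).
  move=> hI; apply/integrableP; split.
    apply/measurable_EFinP/measurable_indic; exact: lebesgue_measurable_itv.
  under eq_integral do rewrite /= ger0_norm ?indic_ge0//.
  rewrite (integral_indic _ mE (lebesgue_measurable_itv I)) setIC.
  by have [+ _] := completed_measure_setI_itv mE hI; rewrite ge0_fin_numE.
have int' I : mu.-integrable E (fun x => (h' I)%:E * (\1_[set` I] x)%:E)%E.
  rewrite /h'; case: ifPn => [/ind hI|_]; first exact: (integrableZl mE).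
  by under eq_fun do rewrite mul0e; exact: integrable0.
transitivity (\int[mu]_(x in E) (\sum_(I <- D) (h' I)%:E * (\1_[set` I] x)%:E)%E)%E.
  apply: eq_integral => x _; rewrite /step -sumEFin.
  by apply: eq_big_seq => I ID; rewrite -EFinM (hh' _ ID).
rewrite (integral_sum mE int') -sumEFin; apply: eq_big_seq => I ID.
have hI : itv_in A B I by exact: hD.
rewrite (integralZl mE (ind _ hI)).
rewrite (integral_indic _ mE (lebesgue_measurable_itv I)) setIC.
have [fin _] := completed_measure_setI_itv mE hI.
by rewrite -[X in (_ * X)%E]fineK// (hh' _ ID).
Qed.
End CompletedLebesgue.

(** * Steep intervals of an absolutely continuous interval function *)

Section Steep.
Context {R : realType}.
Implicit Types (S : set (interval R)) (I J : interval R) (D : {fset interval R}).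

Lemma nonoverlapping_sub D D' :
  (D' `<=` D)%fset -> nonoverlapping D -> nonoverlapping D'.
Proof. by move=> /fsubsetP DD nD I J ID JD; apply: nD; exact: DD. Qed.

(** The interval to be added last has length below [d / 2], so it is enough that
    the others have total length at most [d / 2].  By induction their total length is
    below [d], so absolute continuity bounds the sum of [g] over them by [eps];
    as [g I] is at least [K] times the length of [I], their total length is below
    [eps / K <= d / 2]. *)
Lemma total_length_steep A B S (g : interval R -> R) (eps d K : R) :
  S `<=` itv_in A B -> 0 < d -> 2 * eps <= K * d ->
  (forall D, [set` D] `<=` S -> nonoverlapping D ->
      \sum_(I <- D) itv_length I < d -> \sum_(I <- D) g I < eps) ->
  forall D, [set` D] `<=` S -> nonoverlapping D ->
  {in D, forall I, itv_length I < d / 2 /\ K * itv_length I <= g I} ->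
  \sum_(I <- D) itv_length I < d.
Proof.
move=> hS d0 Kd ac D; have [n] := ubnP #|` D|.
elim: n => // n IH in D *; rewrite ltnS => Dn DS nD hD.
have [->|[I ID]] := fset_0Vmem D; first by rewrite big_seq_fset0.
have := hD _ ID => -[I1 _].
rewrite (big_fsetD1 _ ID)/=; set D' := (D `\ I)%fset.
have sD : (D' `<=` D)%fset by exact: fsubD1set.
have D'S : [set` D'] `<=` S by move=> J /= /(fsubsetP sD)/DS.
have nD' := nonoverlapping_sub sD nD.
have D'd : \sum_(J <- D') itv_length J < d.
  apply: IH => //; last by move=> J /(fsubsetP sD)/hD.
  by rewrite (cardfsD1 I) ID in Dn.
have le1 : K * \sum_(J <- D') itv_length J <= \sum_(J <- D') g J.
  rewrite mulr_sumr big_seq [leRHS]big_seq; apply: ler_sum => J /(fsubsetP sD)/hD[] //.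
have lt1 := ac _ D'S nD' D'd.
have e0 : 0 < eps.
  by have := ac fset0; rewrite !big_seq_fset0; apply.
have len0 : 0 <= \sum_(J <- D') itv_length J.
  by rewrite big_seq sumr_ge0// => J /D'S/hS/itv_length_gt0/ltW.
suff : \sum_(J <- D') itv_length J < d / 2 by lra.
rewrite ltNge; apply/negP => h.
have K0 : 0 < K by rewrite -(pmulr_lgt0 _ d0); lra.
have : K * (d / 2) <= K * \sum_(J <- D') itv_length J by rewrite ler_pM2l.
lra.
Qed.

(** Uniform integrability of the slopes.  Intervals where [g] is positive and
    those where it is negative are treated apart, since absolute continuity only
    controls the absolute value of a sum. *)
Lemma abs_continuous_steep A B S (g : interval R -> R) (eps : R) :
  S `<=` itv_in A B -> abs_continuous_on S g -> 0 < eps ->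
  exists d K : R, [/\ 0 < d, 0 < K & forall D, [set` D] `<=` S ->
    nonoverlapping D -> div_norm D < d ->
    \sum_(I <- D | `|g I| > K * itv_length I) `|g I| < eps].
Proof.
move=> hS ac e0; have e2 : 0 < eps / 2 by rewrite divr_gt0.
have [d d0 hd] := ac _ e2.
exists (d / 2), (eps / d); split; rewrite ?divr_gt0// => D DS nD dD.
set K := eps / d.
have Kd : 2 * (eps / 2) <= K * d by rewrite /K mulfVK ?gt_eqF//; lra.
have len I : I \in D -> 0 <= itv_length I < d / 2.
  move=> ID; apply/andP; split.
    by apply/ltW/(@itv_length_gt0 _ A B)/hS/DS.
  by apply: le_lt_trans dD; exact: le_bigmax_seq.
have main (f : interval R -> R) :
    (forall D', [set` D'] `<=` S -> nonoverlapping D' ->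
      \sum_(I <- D') itv_length I < d -> \sum_(I <- D') f I < eps / 2) ->
    \sum_(I <- D | f I > K * itv_length I) f I < eps / 2.
  move=> hf; rewrite big_fset_condE/=; set D' := [fset _ in _ | _]%fset.
  have sD : (D' `<=` D)%fset by exact: fset_sub.
  have D'S : [set` D'] `<=` S by move=> J /= /(fsubsetP sD)/DS.
  have nD' := nonoverlapping_sub sD nD.
  apply: (hf) => //; apply: (total_length_steep hS d0 Kd hf D'S nD') => I.
  by rewrite !inE/= => /andP[/len/andP[_ ->] /ltW].
have p1 : \sum_(I <- D | g I > K * itv_length I) g I < eps / 2.
  by apply: main => D' D'S nD' D'd; apply: le_lt_trans (ler_norm _) (hd _ _ _ _).
have p2 : \sum_(I <- D | - g I > K * itv_length I) - g I < eps / 2.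
  apply: main => D' D'S nD' D'd; apply: le_lt_trans (hd _ D'S nD' D'd).
  by rewrite sumrN -normrN; exact: ler_norm.
have K0 : 0 < K by rewrite divr_gt0.
rewrite (splitr eps); apply: le_lt_trans (ltrD p1 p2).
rewrite big_mkcond [X in _ <= X + _]big_mkcond [X in _ <= _ + X]big_mkcond/= -big_split/=.
rewrite big_seq [leRHS]big_seq; apply: ler_sum => I /len/andP[l0 _].
have Kl : 0 <= K * itv_length I by rewrite mulr_ge0// ltW.
have [g0|g0] := leP 0 (g I); [rewrite ger0_norm//|rewrite ltr0_norm//];
  do 2 (case: ifPn; rewrite -?leNgt => ?); lra.
Qed.
End Steep.

(** * Points of a division *)

Section Divisions.
Context {R : realType}.
Local Notation mu := (@completed_lebesgue_measure R).
Implicit Types (S : set (interval R)) (I J : interval R) (D : {fset interval R}).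

Definition itv_ends I : set R :=
  if I is Interval (BSide _ a) (BSide _ b) then [set a; b] else set0.

Lemma closure_itv_ends A B I x : itv_in A B I -> closure [set` I] x ->
  ~ itv_ends I x -> x \in I.
Proof.
case: I => -[p a|p] [q b|q] //= /and3P[_ ab _] cx nx.
have : x \in `[a, b].
  have cl : closed `[a, b]%classic by exact: itv_closed.
  have sub : [set` Interval (BSide p a) (BSide q b)] `<=` `[a, b]%classic.
    move=> y /=; rewrite !in_itv/= => /andP[ay yb].
    by rewrite (lteifW ay) (lteifW yb).
  by have := closure_subset sub cx; rewrite -(closure_id _).1.
rewrite !in_itv/= => /andP[ax xb].
have ax' : a < x by rewrite lt_neqAle ax andbT; apply/eqP => xa; apply: nx; left.
have xb' : x < b by rewrite lt_neqAle xb andbT; apply/eqP => xa; apply: nx; right.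
by rewrite !lteifS.
Qed.

Lemma overlap_itv A B I J x : itv_in A B I -> itv_in A B J ->
  x \in I -> x \in J -> ~ itv_ends I x -> ~ itv_ends J x -> overlap I J.
Proof.
case: I => -[p a|p] [q b|q] //= /and3P[_ ab _].
case: J => -[p' a'|p'] [q' b'|q'] //= /and3P[_ ab' _].
rewrite !in_itv/= => /andP[/lteifW ax /lteifW xb] /andP[/lteifW ax' /lteifW xb'] nI nJ.
have {}ax : a < x by rewrite lt_neqAle ax andbT; apply/eqP => e; apply: nI; left.
have {}xb : x < b by rewrite lt_neqAle xb andbT; apply/eqP => e; apply: nI; right.
have {}ax' : a' < x by rewrite lt_neqAle ax' andbT; apply/eqP => e; apply: nJ; left.
have {}xb' : x < b' by rewrite lt_neqAle xb' andbT; apply/eqP => e; apply: nJ; right.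
exists `]Num.max a a', Num.min b b'[, (Num.max a a'), (Num.min b b'); split.
  rewrite /= !lexx/= andbT; apply: (@lt_trans _ _ x).
    by rewrite gt_max ax.
  by rewrite lt_min xb.
move=> y /=; rewrite !in_itv/= gt_max lt_min => /andP[/andP[ay ay'] /andP[yb yb']].
by split; rewrite !lteifS.
Qed.

(** The closures of the intervals of [D] cover [x], and two distinct intervals of
    [D] that contain [x] in their interiors would overlap; so a single term of the
    sum [step h D x] survives. *)
Lemma step_division A B S D x : S `<=` itv_in A B -> division S A B D ->
  x \in `[A, B] -> (forall I, I \in D -> ~ itv_ends I x) ->
  exists2 I, I \in D & x \in I /\ forall h, step h D x = h I.
Proof.
move=> hS [DS nD cov] xAB nx.
have : `[A, B]%classic x by [].
rewrite -cov => -[I /= ID cx].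
have hD J : J \in D -> itv_in A B J by move=> JD; apply/hS/DS.
have xI : x \in I by apply: closure_itv_ends cx _; [exact: hD|exact: nx].
exists I => //; split=> // h.
rewrite /step (big_fsetD1 _ ID)/= indicE mem_set// mulr1 big_seq big1 ?addr0//.
move=> J; rewrite !inE => /andP[JI JD].
rewrite indicE memNset ?mulr0// => /= xJ.
apply: (nD I J ID JD); first by rewrite eq_sym.
by apply: (@overlap_itv A B _ _ x) => //; [exact: hD|exact: hD|exact: nx|exact: nx].
Qed.

Lemma ae_not_ends (u : nat -> {fset interval R}) :
  {ae mu, forall x : R, forall n I, I \in u n -> ~ itv_ends I x}.
Proof.
pose N : set R := \bigcup_n \bigcup_(I in [set` u n]) itv_ends I.
have cN : countable N.
  apply: bigcup_countable => // n _; apply: bigcup_countable => [|I _].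
    exact/finite_set_countable/finite_fset.
  apply: finite_set_countable; case: I => -[p a|p] [q b|q] //=.
exists N; split.
- by apply: sub_caratheodory; exact: countable_measurable.
- exact: (countable_lebesgue_measure0 cN).
- move=> x /= /existsNP[n /existsNP[I /not_implyP[Iu /contrapT xI]]].
  by exists n => //; exists I.
Qed.

End Divisions.

(** * Step functions along a Riemann succession *)

Section Convergence.
Context {R : realType} (A B : R) (S : set (interval R)) (g : interval R -> R).
Context (u : nat -> {fset interval R}).
Hypotheses (hS : S `<=` itv_in A B) (hu : Riemann_succession S A B u).
Local Notation mu := (@completed_lebesgue_measure R).
Hypothesis hder : {ae mu, forall x : R, x \in `[A, B] -> itv_derivable S g x}.

(** There are only countably many end points in a sequence of divisions. *)
Lemma ae_step :
  {ae mu, forall x : R, x \in `[A, B] -> forall n,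
    exists2 I, I \in u n & x \in I /\ forall h, step h (u n) x = h I}.
Proof.
have := ae_not_ends u; apply: filterS => x nx xAB n.
by apply: (step_division hS (hu.1 n) xAB) => I; exact: nx.
Qed.

Lemma succession_itv_in n : [set` u n] `<=` itv_in A B.
Proof. by move=> I Iu; apply: hS; have [+ _ _] := hu.1 n; apply. Qed.

(** Almost everywhere the value at [x] is [phi] of the slope of an interval of [S]
    that contains [x] and is no longer than the norm of [u n].  The map [phi] will be
    the identity, the absolute value or a truncation. *)
Lemma ae_cvg_step (phi : R -> R) : continuous phi ->
  {ae mu, forall x : R, x \in `[A, B] ->
    step (fun I => phi (g I / itv_length I)) (u n) x @[n --> \oo]
      --> phi (itv_derive S g x)}.
Proof.
move=> cphi; move: hder ae_step; apply: filterS2 => x dx sx xAB.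
have /dx cx := xAB; have {}sx := sx xAB.
move=> U /cphi /cx [d /= d0 sub].
have [_ /cvgrPdist_lt/(_ _ d0)] := hu.
apply: filterS => n; rewrite sub0r normrN => nd.
have [I Iu [xI hI]] := sx n; rewrite /= hI; apply: (sub I); split => //.
  by have [+ _ _] := hu.1 n; apply.
apply: le_lt_trans (le_lt_trans (ler_norm _) nd).
exact: le_bigmax_seq.
Qed.

Lemma ae_step_le (h : interval R -> R) (K : R) : (forall I, `|h I| <= K) ->
  {ae mu, forall x : R, x \in `[A, B] -> forall n, `|step h (u n) x| <= K}.
Proof.
move=> hK; have := ae_step; apply: filterS => x sx /sx{}sx n.
by have [I _ [_ ->]] := sx n.
Qed.

(** The derivative is almost everywhere the upper limit of step functions, and
    the measure is complete. *)
Lemma measurable_itv_derive E : lebesgue_measurable E -> E `<=` `[A, B]%classic ->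
  measurable_fun (E : set (caratheodory_type (wlength idfun)^*%mu))
    (fun x : R => (itv_derive S g x)%:E).
Proof.
move=> mE EAB; pose f n x := (step (fun I => g I / itv_length I) (u n) x)%:E.
apply: (ae_measurable_fun completed_lebesgue_measure_is_complete
  (f := fun x => limn_esup (f ^~ x))); last first.
  apply: measurable_fun_limn_esup => n; exact: measurable_step.
have := @ae_cvg_step idfun (fun x => cvg_id); apply: filterS => x + /EAB xAB.
move=> /(_ xAB) cx; have : f ^~ x @ \oo --> (itv_derive S g x)%:E.
  by apply: cvg_EFin; [exact: nearW|exact: cx].
by move=> /cvg_limn_einf_sup[_ ->].
Qed.

Hypothesis hAB : A < B.

Lemma completed_measure_ambient : mu `[A, B]%classic = (B - A)%:E.
Proof. by apply: (@completed_measure_itv _ A B); rewrite /= !lexx hAB. Qed.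

Lemma integrable_cst_ambient E (K : R) : lebesgue_measurable E ->
  E `<=` `[A, B]%classic -> mu.-integrable E (fun=> K%:E).
Proof.
move=> mE EAB; apply: (integrableS (lebesgue_measurable_itv `[A, B]) mE EAB).
apply/integrableP; split; first exact: measurable_cst.
rewrite integral_cst; last exact: lebesgue_measurable_itv.
have := completed_measure_ambient; rewrite /= => ->.
by rewrite -EFinM ltry.
Qed.

(** Almost everywhere the indicators of the intervals of [u n] add up to 1. *)
Lemma sum_measure_le n :
  \sum_(I <- u n) fine (mu (`[A, B]%classic `&` [set` I])) <= B - A.
Proof.
have mW := lebesgue_measurable_itv `[A, B].
have uAB := @succession_itv_in n.
have := integral_step (fun=> 1) mW uAB.
under [in RHS]eq_bigr do rewrite mul1r.
rewrite -lee_fin => <-.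
have <- : (\int[mu]_(x in `[A, B]%classic) 1 = (B - A)%:E)%E.
  by rewrite integral_cst// mul1e; exact: completed_measure_ambient.
apply: ae_ge0_le_integral => //.
- move=> x _; rewrite lee_fin sumr_ge0// => I _; rewrite mul1r indicE//.
- exact: measurable_step.
have := @ae_step_le (fun=> 1) 1 (fun=> _).
rewrite normr1 => /(_ (fun=> lexx _)); apply: filterS => x + /= xAB => /(_ xAB n).
by rewrite lee_fin; apply: le_trans; exact: ler_norm.
Qed.

(** Fatou's lemma for the step functions of the absolute slopes: their integrals
    are at most [1] from the steep intervals plus [K] times the length of
    [`[A, B]] from the others. *)
Lemma integrable_itv_derive_fine (d K : R) : 0 < K ->
  (forall D, [set` D] `<=` S -> nonoverlapping D -> div_norm D < d ->
    \sum_(I <- D | `|g I| > K * itv_length I) `|g I| < 1) ->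
  (forall n, div_norm (u n) < d) ->
  mu.-integrable `[A, B]%classic (fun x : R => (itv_derive S g x)%:E).
Proof.
move=> K0 hK ud; have mW := lebesgue_measurable_itv `[A, B].
apply/integrableP; split; first exact: measurable_itv_derive.
pose f n x := (step (fun I => `|g I / itv_length I|) (u n) x)%:E.
have mf n : measurable_fun
    (`[A, B]%classic : set (caratheodory_type (wlength idfun)^*%mu)) (f n).
  exact: measurable_step.
have f0 n x : `[A, B]%classic x -> (0 <= f n x)%E.
  by move=> _; rewrite lee_fin sumr_ge0// => I _; rewrite mulr_ge0.
have := @fatou _ _ _ mu _ mW f mf f0.
have mg : measurable_fun
    (`[A, B]%classic : set (caratheodory_type (wlength idfun)^*%mu))
    (fun x : R => `|(itv_derive S g x)%:E|%E).
  by apply: measurableT_comp => //; exact: measurable_itv_derive.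
have fg : ae_eq mu `[A, B]%classic (fun x : R => `|(itv_derive S g x)%:E|%E)
    (fun x => limn_einf (f^~ x)).
  have := @ae_cvg_step (fun r => `|r|) (@norm_continuous _ R^o).
  apply: filterS => x + xAB => /(_ xAB) cx.
  have : f ^~ x @ \oo --> (`|itv_derive S g x|)%:E.
    by apply: cvg_EFin; [exact: nearW|exact: cx].
  by move=> /cvg_limn_einf_sup[-> _].
have mh := ae_measurable_fun completed_lebesgue_measure_is_complete fg mg.
rewrite -(ae_eq_integral _ _ mW mg mh fg).
move=> /le_lt_trans; apply.
have bound n : (\int[mu]_(x in `[A, B]) f n x <= (1 + K * (B - A))%:E)%E.
  have uAB := @succession_itv_in n.
  rewrite /f (integral_step _ mW uAB) lee_fin.
  have [uS nu _] := hu.1 n.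
  have := hK _ uS nu (ud n); have := sum_measure_le n.
  rewrite -(ler_pM2l K0) mulr_sumr => h1 h2.
  apply: le_trans (lerD (ltW h2) h1).
  rewrite [X in _ <= X + _]big_mkcond/= -big_split/= big_seq [leRHS]big_seq.
  apply: ler_sum => I /uAB hI.
  have [_ /andP[m0 mI]] := completed_measure_setI_itv mW hI.
  have l0 := itv_length_gt0 hI.
  rewrite normrM normfV (gtr0_norm l0).
  case: ifPn => [_|].
    apply: (@le_trans _ _ (`|g I|)); last by rewrite lerDl mulr_ge0// ltW.
    rewrite mulrAC ler_pdivrMr//; exact: ler_wpM2l.
  rewrite -leNgt add0r -ler_pdivrMr// => h; exact: ler_wpM2r.
rewrite limn_einf_lim; apply: (@le_lt_trans _ _ (1 + K * (B - A))%:E);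
  last exact: ltry.
apply: lime_le; first exact: is_cvg_einfs.
apply: nearW => n; apply: le_trans (bound n).
apply: ereal_inf_lbound; exists n => //=.
Qed.

End Convergence.

(** * Truncation *)

Section Clamp.
Context {R : realType}.
Implicit Types K r : R.

Definition clamp K r : R := Num.max (- K) (Num.min K r).

Lemma continuous_clamp K : continuous (clamp K).
Proof.
move=> r; apply: (@continuous_max R R (fun=> - K) (fun r => Num.min K r)).
  exact: cvg_cst.
apply: (@continuous_min R R (fun=> K) id); first exact: cvg_cst.
exact: cvg_id.
Qed.

Lemma clamp_id K r : `|r| <= K -> clamp K r = r.
Proof.
by rewrite ler_norml => /andP[? ?]; rewrite /clamp (min_idPr _)// (max_idPr _).
Qed.

Lemma clamp_le K r : 0 <= K -> `|clamp K r| <= K.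
Proof.
move=> K0; rewrite /clamp /Num.min /Num.max ler_norml.
by case: (ltP K r) => ?; case: ifPn; rewrite -?leNgt => ?; apply/andP; split; lra.
Qed.

Lemma clamp_le_norm K r : 0 <= K -> `|clamp K r| <= `|r|.
Proof.
move=> K0; have [rK|rK] := leP `|r| K; first by rewrite clamp_id.
exact: le_trans (clamp_le _ K0) (ltW rK).
Qed.

Lemma clamp_dist K r : 0 <= K -> `|r - clamp K r| <= `|r|.
Proof.
move=> K0; have [rK|rK] := leP `|r| K; first by rewrite clamp_id// subrr normr0.
move: rK; rewrite /clamp /Num.min /Num.max.
have [r0|r0] := leP 0 r; [rewrite (ger0_norm r0)|rewrite (ltr0_norm r0)] => rK.
  by rewrite rK; case: ifPn => ?; rewrite ger0_norm; lra.
have -> : K < r = false by apply/negbTE; rewrite -leNgt; lra.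
by case: ifPn; rewrite -?leNgt => ?; rewrite ler0_norm; lra.
Qed.

End Clamp.

(** * Convergence of density sums *)

Section DensitySums.
Context {R : realType} (A B : R) (S : set (interval R)) (g : interval R -> R).
Hypotheses (hAB : A < B) (hS : S `<=` itv_in A B) (hac : abs_continuous_on S g).
Local Notation mu := (@completed_lebesgue_measure R).
Hypothesis hder : {ae mu, forall x : R, x \in `[A, B] -> itv_derivable S g x}.

Lemma Riemann_succession_norm_lt u d : Riemann_succession S A B u -> 0 < d ->
  \forall n \near \oo, div_norm (u n) < d.
Proof.
move=> [_ /cvgrPdist_lt/(_ _ _)] h d0; have := h _ d0; apply: filterS => n.
by rewrite sub0r normrN; apply: le_lt_trans; exact: ler_norm.
Qed.

(** Dropping finitely many divisions leaves a Riemann succession whose norms are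
    all small enough for [integrable_itv_derive_fine]. *)
Lemma integrable_itv_derive u : Riemann_succession S A B u ->
  mu.-integrable `[A, B]%classic (fun x : R => (itv_derive S g x)%:E).
Proof.
move=> hu; have [d [K [d0 K0 hK]]] := abs_continuous_steep hS hac ltr01.
have [N _ hN] := Riemann_succession_norm_lt hu d0.
have hu' : Riemann_succession S A B (fun n => u (n + N)%N).
  split=> [n|]; first exact: hu.1.
  by have := hu.2; rewrite -(cvg_shiftn N).
apply: (integrable_itv_derive_fine hS hu' hder hAB K0 hK) => n.
by apply: hN => /=; exact: leq_addl.
Qed.

(** Truncation at [K] does not alter slopes of absolute value at most [K0], and
    changes the term of a steep interval [I] by at most [`|g I|]. *)
Lemma density_sum_clamp E (eps d K0 K : R) D : lebesgue_measurable E ->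
  0 < K0 -> K0 <= K ->
  (forall D, [set` D] `<=` S -> nonoverlapping D -> div_norm D < d ->
    \sum_(I <- D | `|g I| > K0 * itv_length I) `|g I| < eps) ->
  [set` D] `<=` S -> nonoverlapping D -> div_norm D < d ->
  `|\sum_(I <- D) density_summand g E I
    - \sum_(I <- D) clamp K (g I / itv_length I) * fine (mu (E `&` [set` I]))|
  < eps.
Proof.
move=> mE K00 K0K hK DS nD Dd; apply: le_lt_trans (hK D DS nD Dd).
rewrite -sumrB; apply: le_trans (ler_norm_sum _ _ _) _.
rewrite [leRHS]big_mkcond big_seq [leRHS]big_seq; apply: ler_sum => I /DS/hS hI.
have [_ /andP[m0 mI]] := completed_measure_setI_itv mE hI.
have l0 := itv_length_gt0 hI.
rewrite /density_summand mulrAC -mulrBl normrM (ger0_norm m0).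
have rE : `|g I / itv_length I| = `|g I| / itv_length I.
  by rewrite normrM normfV (gtr0_norm l0).
case: ifPn => [_|].
  apply: (@le_trans _ _ (`|g I / itv_length I| * itv_length I)).
    apply: ler_pM => //; apply: clamp_dist; exact: le_trans (ltW K00) K0K.
  by rewrite rE divfK ?gt_eqF.
rewrite -leNgt -ler_pdivrMr// -rE => h.
by rewrite clamp_id ?subrr ?normr0 ?mul0r//; exact: le_trans h K0K.
Qed.

(** An argument in three parts, each with error below [eps / 3]: truncate the
    derivative at a large [k], replace it by the truncated step function of [u n]
    for large [n], and remove the truncation by [density_sum_clamp]. *)
Lemma density_sums_cvg E u : lebesgue_measurable E -> E `<=` `[A, B]%classic ->
  Riemann_succession S A B u ->
  \sum_(I <- u n) density_summand g E I @[n --> \oo]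
    --> fine (lebesgue_itv_integral S g E).
Proof.
move=> mE EAB hu.
have ig : mu.-integrable E (fun x : R => (itv_derive S g x)%:E).
  by apply: integrableS (integrable_itv_derive hu) => //; exact: lebesgue_measurable_itv.
have mg := measurable_int _ ig.
have mc (K : R) : measurable_fun (E : set (caratheodory_type (wlength idfun)^*%mu))
    (fun x : R => (clamp K (itv_derive S g x))%:E).
  apply/measurable_EFinP; apply: (measurableT_comp (f := clamp K)).
    by apply: continuous_measurable_fun; exact: continuous_clamp.
  by apply/measurable_EFinP.
(* The untruncated derivative dominates all of its truncations. *)
have cl : fine (\int[mu]_(x in E) (clamp k%:R (itv_derive S g x))%:E)%E @[k --> \oo] -->
    fine (lebesgue_itv_integral S g E).
  apply: fine_cvg; rewrite fineK; last exact: integrable_fin_num.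
  have := @dominated_convergence _ _ _ mu E mE
    (fun k (x : R) => (clamp k%:R (itv_derive S g x))%:E)
    (fun x : R => (itv_derive S g x)%:E)
    (fun x : R => `|(itv_derive S g x)%:E|%E) (fun k => mc k%:R) mg.
  case=> //.
  - apply: nearW => x _; apply: cvg_EFin; first exact: nearW.
    apply: cvg_near_cst; have [N _ hN] := nbhs_infty_ger `|itv_derive S g x|.
    by exists N => // k /= Nk; rewrite clamp_id//; exact: hN.
  - exact: integrable_abse.
  - by apply: nearW => x n _; rewrite lee_fin clamp_le_norm.
(* For a fixed truncation level, the constant [K] dominates the step functions. *)
have st (K : R) : 0 <= K ->
    \sum_(I <- u n) clamp K (g I / itv_length I) * fine (mu (E `&` [set` I]))
      @[n --> \oo] -->
    fine (\int[mu]_(x in E) (clamp K (itv_derive S g x))%:E)%E.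
  move=> K0.
  have := @dominated_convergence _ _ _ mu E mE
    (fun n (x : R) => (step (fun I => clamp K (g I / itv_length I)) (u n) x)%:E)
    (fun x : R => (clamp K (itv_derive S g x))%:E)
    (fun x : R => K%:E) (fun n => @measurable_step _ _ _ _) (mc K).
  case=> //.
  - have := ae_cvg_step hS hu hder (@continuous_clamp R K).
    apply: filterS => x + /EAB xAB => /(_ xAB) cx.
    by apply: cvg_EFin; [exact: nearW|exact: cx].
  - exact: (integrable_cst_ambient hAB K mE EAB).
  - have := ae_step_le hS hu (fun I => clamp_le (g I / itv_length I) K0).
    by apply: filterS => x + n /EAB xAB => /(_ xAB n); rewrite lee_fin.
  move=> ic _ cv; have -> : (fun n => \sum_(I <- u n)
      clamp K (g I / itv_length I) * fine (mu (E `&` [set` I]))) =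
      (fun n => fine (\int[mu]_(x in E)
        (step (fun I => clamp K (g I / itv_length I)) (u n) x)%:E)%E).
    apply/funext => n; rewrite (@integral_step _ A B)//.
    exact: succession_itv_in hS hu n.
  by apply: fine_cvg; rewrite fineK; [exact: cv|exact: integrable_fin_num].
apply/cvgrPdist_lt => eps e0; have e3 : 0 < eps / 3 by rewrite divr_gt0.
have [d [K0 [d0 K00 hK]]] := abs_continuous_steep hS hac e3.
have [k [kK kl]] : exists k : nat, K0 <= k%:R /\
    `|fine (lebesgue_itv_integral S g E) -
      fine (\int[mu]_(x in E) (clamp k%:R (itv_derive S g x))%:E)%E| < eps / 3.
  move/cvgrPdist_lt : cl => /(_ _ e3) cl.
  have := filterI (nbhs_infty_ger K0) cl.
  by move=> [N _ hN]; exists N; have [] := hN N (leqnn N).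
have := Riemann_succession_norm_lt hu d0.
move/cvgrPdist_lt : (st k%:R (ler0n _ _)) => /(_ _ e3).
apply: filterS2 => n h1 h2.
have [uS nu _] := hu.1 n.
have h3 := density_sum_clamp mE K00 kK hK uS nu h2.
move: kl h1 h3; rewrite !ltr_norml => /andP[? ?] /andP[? ?] /andP[? ?].
by apply/andP; split; lra.
Qed.

End DensitySums.

(** * Upper and lower density integrals *)

Section Densities.
Context {R : realType}.

Lemma at_right_lim_eq (f : R -> \bar R) (L : R) :
  (forall eps, 0 < eps -> exists2 d, 0 < d &
    forall e, 0 < e -> e < d -> ((L - eps)%:E <= f e <= (L + eps)%:E)%E) ->
  lim (f e @[e --> 0^'+]) = L%:E.
Proof.
move=> hf; apply/cvg_lim => //; apply/fine_cvgP.
have near_fin eps : 0 < eps -> \forall e \near 0^'+,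
    ((L - eps)%:E <= f e <= (L + eps)%:E)%E.
  move=> /hf[d d0 hd]; have := nbhs_right_lt d0.
  by have := nbhs_right_gt (0 : R); apply: filterS2 => e; exact: hd.
have fin eps e : ((L - eps)%:E <= f e <= (L + eps)%:E)%E -> f e \is a fin_num.
  by case/andP; case: (f e) => [r| |]//; rewrite ?leye_eq ?leeNy_eq.
split; first by have := near_fin 1 ltr01; apply: filterS => e; exact: fin.
apply/cvgrPdist_le => eps /near_fin; apply: filterS => e /= h.
move: (h); rewrite -(fineK (fin _ _ h)) !lee_fin => /andP[? ?].
by rewrite ler_norml; apply/andP; split; lra.
Qed.

(** Otherwise, for every [n], some division of norm below [1 / (n + 1)] has a
    density sum at distance at least [eps] from the integral; these divisions form a
    Riemann succession that contradicts [density_sums_cvg]. *)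
Lemma division_sums_near (A B : R) S g E : A < B -> S `<=` itv_in A B ->
  abs_continuous_on S g ->
  {ae completed_lebesgue_measure,
     forall x : R, x \in `[A, B] -> itv_derivable S g x} ->
  lebesgue_measurable E -> E `<=` `[A, B]%classic ->
  forall eps, 0 < eps -> exists2 d, 0 < d &
    forall D, division S A B D -> div_norm D < d ->
    `|fine (lebesgue_itv_integral S g E)
       - \sum_(I <- D) density_summand g E I| < eps.
Proof.
move=> hAB hS hac hder mE EAB eps e0; apply: contrapT => no.
have bad n : exists D, [/\ division S A B D, div_norm D < n.+1%:R^-1 &
    eps <= `|fine (lebesgue_itv_integral S g E)
       - \sum_(I <- D) density_summand g E I|].
  apply: contrapT => nD; apply: no; exists n.+1%:R^-1; first by rewrite invr_gt0.
  move=> D DW Dn; rewrite ltNge; apply/negP => h; apply: nD; by exists D; split.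
have [u hu] := choice bad.
have ru : Riemann_succession S A B u.
  split=> [n|]; first by have [] := hu n.
  apply: (@squeeze_cvgr _ _ _ _ (fun=> 0) (fun n => n.+1%:R^-1)).
  - near=> n; apply/andP; split; last by have [_ /ltW] := hu n.
    by apply: bigmax_ge_id.
  - exact: cvg_cst.
  - exact: cvg_harmonic.
have := density_sums_cvg hAB hS hac hder mE EAB ru.
move=> /cvgrPdist_lt/(_ _ e0)[N _ /(_ N (leqnn N))] /=.
by have [_ _] := hu N; rewrite leNgt => /negP.
Unshelve. all: by end_near. Qed.

End Densities.

Theorem mainTheorem16 (R : realType) (A B : R) (hAB : A < B)
  (S : set (interval R)) (hS : forall I, S I -> itv_in A B I)
  (g : interval R -> R)
  (F : set (nat -> {fset interval R})) (hF : succession_family S A B F)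
  (hadd : additive_on S g) (hac : abs_continuous_on S g)
  (hder : {ae completed_lebesgue_measure,
             forall x : R, x \in `[A, B] -> itv_derivable S g x})
  (E : set R) (hE : lebesgue_measurable E) (hEW : E `<=` `[A, B]%classic) :
  [/\ completed_lebesgue_measure.-integrable `[A, B]%classic
        (fun x : R => (itv_derive S g x)%:E),
      upper_density_integral S A B g (occurring F) E
        = lebesgue_itv_integral S g E &
      lower_density_integral S A B g (occurring F) E
        = lebesgue_itv_integral S g E].
Proof.
have [_ [u Fu ru] _] := hF.
have ig := integrable_itv_derive hAB hS hac hder ru.
set L := lebesgue_itv_integral S g E.
have Lfin : L = (fine L)%:E.
  rewrite fineK//; apply: integrable_fin_num => //; apply: integrableS ig => //.
  exact: lebesgue_measurable_itv.
have nonempty e : 0 < e -> exists s, density_sums S A B g (occurring F) E e s.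
  move=> e0; have [N _ hN] := Riemann_succession_norm_lt ru e0.
  exists (\sum_(I <- u N) density_summand g E I)%:E; exists (u N) => //; split.
  - by exists u => //; exists N.
  - exact: ru.1.
  - by apply: hN => /=.
have close eps : 0 < eps -> exists2 d, 0 < d & forall e s, e < d ->
    density_sums S A B g (occurring F) E e s ->
    ((fine L - eps)%:E <= s <= (fine L + eps)%:E)%E.
  move=> e0; have [d d0 hd] := division_sums_near hAB hS hac hder hE hEW e0.
  exists d => // e _ ed [D [_ DW De] <-]; rewrite !lee_fin.
  have := hd D DW (lt_trans De ed); rewrite -/L ltr_norml => /andP[? ?].
  by apply/andP; split; lra.
split=> //; rewrite Lfin; apply: at_right_lim_eq => eps /close[d d0 hd];
    exists d => // e e0 ed; have [s es] := nonempty _ e0;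
    have /andP[sl sr] := hd _ _ ed es; apply/andP; split.
- exact: le_trans sl (ereal_sup_ubound es).
- by apply: ge_ereal_sup => t /(hd _ _ ed)/andP[].
- by apply: le_ereal_inf_tmp => t /(hd _ _ ed)/andP[].
- exact: le_trans (ereal_inf_lbound es) sr.
Qed.
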